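(* For every graph $H$ there is a constant $c(H)$ such that $r_{\textrm{ind}}(H;k) \leq k^{c(H)k}$ for every integer $k \geq 2$.
   Context: For graphs $G,H$ and a positive integer $k$, write $G \xrightarrow{\textrm{ind}} (H;k)$ if for every $k$-coloring of the edges of $G$ there is an induced subgraph of $G$ isomorphic to $H$ all of whose edges have the same color. The induced Ramsey number $r_{\textrm{ind}}(H;k)$ is the minimum number of vertices of a graph $G$ with $G \xrightarrow{\textrm{ind}} (H;k)$. *)

(* Defs.v *)
From mathcomp Require Import all_boot.

Set Implicit Arguments.
Unset Strict Implicit.
Unset Printing Implicit Defensive.

Record sgraph := SGraph {
  vertex :> finType;
  adj : rel vertex;
  adj_sym : symmetric adj;
  adj_irr : irreflexive adj
}.

Definition edges (G : sgraph) : {set {set G}} :=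
  [set [set p.1; p.2] | p in [set p : G * G | adj p.1 p.2]].

Definition edge (G : sgraph) := {e : {set G} | e \in edges G}.

Section Induced.
Variables (G : sgraph) (S : {set G}).

Definition induced_adj : rel {x : G | x \in S} :=
  fun u v => adj (val u) (val v).

Lemma induced_adj_sym : symmetric induced_adj.
Proof. by move=> u v; apply: adj_sym. Qed.

Lemma induced_adj_irr : irreflexive induced_adj.
Proof. by move=> u; apply: adj_irr. Qed.

Definition induced : sgraph := SGraph induced_adj_sym induced_adj_irr.

End Induced.

Definition isomorphic (G H : sgraph) : Prop :=
  exists2 f : G -> H, bijective f & forall x y, adj (f x) (f y) = adj x y.

(* The edges of [induced S] are the edges of [G] contained in [S]. *)
Definition monochromatic (G : sgraph) (k : nat) (c : edge G -> 'I_k)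
    (S : {set G}) : Prop :=
  forall e e' : edge G, val e \subset S -> val e' \subset S -> c e = c e'.

Definition ind_arrow (G H : sgraph) (k : nat) : Prop :=
  forall c : edge G -> 'I_k,
    exists2 S : {set G}, isomorphic (induced S) H & monochromatic c S.

(* The induced Ramsey number is given by its graph, so that asserting a value
   includes the existence of some [G] with [ind_arrow G H k]. *)
Definition is_ind_ramsey (H : sgraph) (k r : nat) : Prop :=
  (exists2 G : sgraph, ind_arrow G H k & #|G| = r) /\
  (forall G : sgraph, ind_arrow G H k -> r <= #|G|).

(* Main.v *)
Require Import Defs.
From mathcomp Require Import all_boot zify.
From Stdlib Require Import Classical.

Set Implicit Arguments.
Unset Strict Implicit.
Unset Printing Implicit Defensive.

(** Let [r = k ^ (k * #|H|)], so that every [k]-colouring of the complete graph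
    on [r] vertices contains a monochromatic clique on [#|H|] vertices.  A
    uniformly random graph on [n] vertices, with [n] a suitable power of [r],
    works with positive probability.  Record a graph together with a colouring
    as the set of triples (pair of vertices, colour or "non-edge"): having no
    induced monochromatic [H] means being independent in the hypergraph whose
    hyperedges are the potential copies of [H].  The container method covers all
    independent sets by few sets [C] spanning few hyperedges.  If for nearly
    every pair both "non-edge" and some colour were still allowed by [C], Ramsey
    on random [r]-sets would produce many hyperedges inside [C]; so each [C]
    decides the adjacency of about [n ^ 2 / r ^ 2] pairs, and the union bound
    over the containers leaves a graph that is not covered. *)

Lemma card_bigcup_le (I T : finType) (P : pred I) (F : I -> {set T}) :
  #|\bigcup_(i | P i) F i| <= \sum_(i | P i) #|F i|.
Proof.
elim/big_rec2: _ => [|i n R _ IHn]; first by rewrite cards0.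
by apply: leq_trans (leq_card_setU _ _) _; rewrite leq_add2l.
Qed.

(** * Hypergraph containers *)

Section Container.

Variables (Omega V : finType) (J : eqType) (p : J -> Omega -> V).
Implicit Types (E F : {set Omega}) (I R : {set V}) (js : seq J) (T : seq V).

(** Hyperedges are labels [w] with an indexed list of vertices [p j w], so passing to a link only
    means dropping an index from [js]. *)
Definition deg E j v := #|[set w in E | p j w == v]|.

Definition indep E js I :=
  forall w, w \in E -> exists2 j, j \in js & p j w \notin I.

(** Counting over all labels rather than over some [E] lets the bound pass unchanged to
    sub-hypergraphs and links. *)
Definition codeg_le js kap := forall j j' u v, j \in js -> j' \in js ->
  j != j' -> #|[set w | (p j w == u) && (p j' w == v)]| <= kap.

Lemma sum_deg E j : \sum_v deg E j v = #|E|.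
Proof.
rewrite -sum1_card (partition_big (p j) predT) //=; apply: eq_bigr => v _.
by rewrite /deg -sum1_card; apply: eq_bigl => w; rewrite inE.
Qed.

(** * Elimination of one coordinate by a greedy sequence *)

Section Level.

Variables (E : {set Omega}) (j : J) (js : seq J) (A D h : nat).

(* Hyperedges meeting a vertex that already has degree [h] in [F] are discarded,
   which keeps all degrees of the hypergraph [acc T] at most [h + kap]. *)
Definition fresh F t :=
  [set w in E | (p j w == t) && all (fun j' => deg F j' (p j' w) < h) js].

Fixpoint acc T := if T is t :: T' then acc T' :|: fresh (acc T') t else set0.

Definition rich F := [set t | D <= 4 * A * #|fresh F t|].

Fixpoint valid T :=
  if T is t :: T' then [&& t \in rich (acc T'), t \notin T' & valid T'] else true.

Lemma greedy_seq I b : exists T, [/\ valid T, {subset T <= I} &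
  size T = b \/ size T < b /\ {subset I :&: rich (acc T) <= T}].
Proof.
elim: b => [|b [T [vT TI [sT|[sT HT]]]]]; first by exists [::]; split => //; left.
- case: (boolP [exists t in I :&: rich (acc T), t \notin T]) => [|Hn].
    case/existsP => t /andP[/setIP[tI tX] tT].
    exists (t :: T); split; [by rewrite /= tX tT | | by left; rewrite /= sT].
    by move=> u; rewrite inE => /orP[/eqP->|/TI].
  exists T; split => //; right; split; first by rewrite sT.
  move=> t Ht; apply: contraR Hn => tT; apply/existsP; exists t.
  by rewrite Ht.
- by exists T; split => //; right; split => //; lia.
Qed.

Lemma acc_sub T : acc T \subset E.
Proof.
elim: T => [|t T IH] /=; first exact: sub0set.
by rewrite subUset IH; apply/subsetP => w; rewrite inE => /andP[].
Qed.

Lemma acc_mem T w : w \in acc T -> p j w \in T.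
Proof.
elim: T => [|t T IH] /=; first by rewrite inE.
rewrite !inE => /orP[/IH ->|/and3P[_ -> _]] //; exact: orbT.
Qed.

(** Each vertex of a valid sequence adds at least [D / (4 * A)] hyperedges; these batches are
    disjoint since their [j]-coordinates differ. *)
Lemma acc_ge T : valid T -> D * size T <= 4 * A * #|acc T|.
Proof.
elim: T => [|t T IH] /=; first by rewrite muln0.
case/and3P; rewrite inE => tX tT /IH {}IH.
rewrite cardsU disjoint_setI0 ?cards0 ?subn0; first by lia.
rewrite -setI_eq0; apply/eqP/setP => w; rewrite !inE; apply/negP.
by case/andP => /acc_mem wT /and3P[_ /eqP wt _]; rewrite wt (negPf tT) in wT.
Qed.

Lemma acc_le T : (forall v, deg E j v <= D) -> #|acc T| <= size T * D.
Proof.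
move=> dE; elim: T => [|t T IH] /=; first by rewrite cards0.
rewrite mulSn addnC; apply: leq_trans (leq_card_setU _ _) _.
apply: leq_add => //; apply: leq_trans (dE t); apply: subset_leq_card.
by apply/subsetP => w; rewrite !inE => /and3P[-> ->].
Qed.

(** Once its degree reaches [h], a vertex [v] gains no more; before that, one step adds only
    hyperedges with both coordinates [t] and [v] fixed, at most [kap] of them. *)
Lemma acc_deg kap T j' v : codeg_le (j :: js) kap -> uniq (j :: js) ->
  j' \in js -> deg (acc T) j' v <= h + kap.
Proof.
move=> cod /andP[jjs _] j'js; elim: T => [|t T IH] /=.
  by rewrite /deg (_ : [set _ in _ | _] = set0) ?cards0 //; apply/setP => w; rewrite !inE.
have -> : deg (acc T :|: fresh (acc T) t) j' v =
   #|[set w in acc T | p j' w == v] :|: [set w in fresh (acc T) t | p j' w == v]|.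
  by congr #|pred_of_set _|; apply/setP => w; rewrite !inE andb_orl.
case: (ltnP (deg (acc T) j' v) h) => dv.
  apply: leq_trans (leq_card_setU _ _) _; apply: leq_add; first exact: ltnW.
  apply: leq_trans (cod j j' t v _ _ _); rewrite ?inE ?eqxx ?j'js ?orbT //.
    by apply: subset_leq_card; apply/subsetP => w; rewrite !inE => /andP[/and3P[_ -> _] ->].
  by apply: contraNneq jjs => ->.
rewrite (_ : [set w in fresh _ _ | _] = set0) ?setU0 //.
apply/setP => w; rewrite !inE; apply/negP => /andP[/and3P[_ _ /allP/(_ _ j'js)]].
by move=> lt /eqP wv; rewrite wv ltnNge dv in lt.
Qed.

(** Each coordinate has at most [b * D / h] saturated vertices, so in all they spoil at most
    [#|V| * D / (2 * A)] hyperedges, half of the lower bound on [#|E|]. Vertices that are not rich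
    carry at most half of what remains of that bound, and a rich one carries at most [D]. *)
Lemma rich_ge F b s : 0 < D -> 0 < h -> size js <= s ->
  (forall j' v, j' \in j :: js -> deg E j' v <= D) ->
  #|V| * D <= A * #|E| -> 2 * s * b * D * A <= h * #|V| -> #|F| <= b * D ->
  #|V| <= 4 * A * #|rich F|.
Proof.
move=> D0 h0 sjs dE EN hN Fb.
pose bad j' := [set w in E | h <= deg F j' (p j' w)].
have badE j' : j' \in js -> h * #|bad j'| <= b * D * D.
  move=> j'js.
  pose S := [set v | h <= deg F j' v].
  have S1 : #|S| * h <= b * D.
    apply: leq_trans Fb; rewrite -(sum_deg F j') -sum_nat_const.
    rewrite [X in _ <= X](bigID (mem S)) /=; apply: leq_trans (leq_addr _ _).
    by apply: leq_sum => v; rewrite inE.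
  have S2 : #|bad j'| <= #|S| * D.
    rewrite -sum1_card (partition_big (p j') (mem S)) /=; last first.
      by move=> w; rewrite !inE => /andP[].
    rewrite -sum_nat_const; apply: leq_sum => v _.
    apply: leq_trans (dE j' v _); last by rewrite inE j'js orbT.
    rewrite sum1_card; apply: subset_leq_card; apply/subsetP => w.
    by rewrite !inE -topredE /= !inE => /andP[/andP[-> _] ->].
  apply: leq_trans (leq_mul (leqnn h) S2) _.
  by rewrite mulnA [h * _]mulnC leq_mul2r S1 orbT.
have badU : 2 * A * \sum_(j' <- js) #|bad j'| <= #|V| * D.
  rewrite -(leq_pmul2l h0).
  have : h * \sum_(j' <- js) #|bad j'| <= s * (b * D * D).
    apply: (@leq_trans (size js * (b * D * D))); last by rewrite leq_mul2r sjs orbT.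
    rewrite big_distrr /= -sum1_size big_distrl /= big_seq [X in _ <= X]big_seq.
    by apply: leq_sum => j' Hj; rewrite mul1n; apply: badE.
  move/(leq_mul (leqnn (2 * A))) => H1.
  have := leq_mul hN (leqnn D).
  lia.
have cov : #|E| <= \sum_t #|fresh F t| + \sum_(j' <- js) #|bad j'|.
  pose gd := [set w in E | all (fun j' => deg F j' (p j' w) < h) js].
  have -> : \sum_t #|fresh F t| = #|gd|.
    rewrite -(sum_deg gd j); apply: eq_bigr => t _; congr #|pred_of_set _|.
    by apply/setP => w; rewrite !inE -andbA [_ && (_ == _)]andbC.
  apply: (@leq_trans (#|gd| + #|\bigcup_(j' <- js) bad j'|)).
    apply: leq_trans (leq_card_setU _ _); apply: subset_leq_card.
    apply/subsetP => w wE; rewrite !inE wE /=; case: allP => //= Hn.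
    have /allPn[j' j'js] : ~~ all (fun j' => deg F j' (p j' w) < h) js by apply/allP.
    rewrite -leqNgt => hle; rewrite (big_rem j') //= !inE wE hle //.
  rewrite leq_add2l; elim: (js) => [|j' l IH]; first by rewrite !big_nil cards0.
  by rewrite !big_cons; apply: leq_trans (leq_card_setU _ _) _; rewrite leq_add2l.
have split4 : 4 * A * \sum_t #|fresh F t| <= 4 * A * (#|rich F| * D) + #|V| * D.
  rewrite (bigID (mem (rich F))) /= mulnDr; apply: leq_add.
    rewrite leq_mul2l -sum_nat_const; apply/orP; right; apply: leq_sum => t _.
    apply: leq_trans (dE j t _); last by rewrite inE eqxx.
    by apply: subset_leq_card; apply/subsetP => w; rewrite !inE => /and3P[-> ->].
  rewrite big_distrr /= -[#|V|]sum1_card big_distrl /= [X in _ <= X](bigID (mem (rich F))) /=.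
  apply: leq_trans (leq_addl _ _); apply: leq_sum => t.
  by rewrite inE -ltnNge mul1n; apply: ltnW.
rewrite -(leq_pmul2r D0).
have := leq_mul (leqnn A) cov; rewrite mulnDr; lia.
Qed.

End Level.

Variables (s b kap Gam : nat).

(* The density of the hypergraph degrades from [1 / A] to
   [1 / (32 * s * A ^ 2)] when one coordinate is eliminated. *)
Fixpoint loss m A := if m is m'.+1 then loss m' (32 * s * A ^ 2) else 8 * A.

Lemma loss_ge m A : 0 < s -> 8 * A <= loss m A.
Proof.
move=> s0; elim: m A => [|m IH] A //=; apply: leq_trans (IH _); nia.
Qed.

(** Padding with [None] bounds the number of possible greedy sequences by [#|V|.+1 ^ b]. *)
Lemma seq_pmap_tuple T : size T <= b ->
  exists t : b.-tuple (option V), pmap id t = T.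
Proof.
move=> sT; have st : size (map some T ++ nseq (b - size T) None) == b.
  by rewrite size_cat size_map size_nseq subnKC.
exists (Tuple st); rewrite /= pmap_cat [X in _ ++ X](_ : _ = [::]).
  by rewrite cats0 -[RHS]map_id; elim: T {sT st} => //= t T ->.
by elim: (b - _).
Qed.

(* An independent set either contains few rich vertices, and then the other rich
   vertices can be removed, or it contains [b] of them, and then it is independent
   in their joint link, which has one coordinate less.  In both cases what is
   removed depends only on a sequence of at most [b] elements. The hypothesis on
   [kap] ensures that the trivial bound on codegrees stays below the saturation
   threshold at every level. *)
Lemma removal_step js E A D (W : {set V}) :
    0 < size js -> uniq js -> size js <= s -> codeg_le js kap -> 0 < #|V| ->
    0 < A -> 0 < D -> 0 < kap ->
    (forall j v, j \in js -> deg E j v <= D) ->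
    (forall j w, j \in js -> w \in E -> p j w \in W) ->
    #|V| * D <= A * #|E| ->
    kap * #|V| ^ (size js).-1 <= b ^ (size js).-1 * D ->
    loss (size js) A <= Gam -> Gam * b <= #|V| ->
  exists RR : {set {set V}},
    [/\ #|RR| <= (#|V|.+1 ^ b) ^ size js,
        forall R, R \in RR -> #|V| <= Gam * #|R| /\ R \subset W &
        forall I, indep E js I -> exists2 R, R \in RR & [disjoint R & I]].
Proof.
elim: js E A D => // j js IH E A D _ ujs sjs cod V0 A0 D0 k0 dE EW EN kN lG Gb.
have s0 : 0 < s by apply: leq_trans sjs.
have AG : 8 * A <= Gam by apply: leq_trans lG; apply: loss_ge.
have [js0|js0] := posnP (size js).
  (* With one coordinate left, an independent set avoids all of [p j @: E], which is large by the
     degree bound. *)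
  exists [set p j @: E]; split.
  - by rewrite cards1 !expn_gt0.
  - move=> R /set1P ->; split; last first.
      by apply/subsetP => _ /imsetP[w wE ->]; apply: EW; rewrite ?inE ?eqxx.
    have imE : #|E| <= #|p j @: E| * D.
      rewrite -sum1_card (partition_big (p j) (mem (p j @: E))) /=; last first.
        by move=> w wE; apply: imset_f.
      rewrite -sum_nat_const; apply: leq_sum => v _.
      apply: leq_trans (dE j v _); last by rewrite inE eqxx.
      rewrite sum1_card; apply: subset_leq_card; apply/subsetP => w.
      by rewrite !inE -topredE.
    rewrite -(leq_pmul2r D0); apply: leq_trans EN _.
    apply: leq_trans (leq_mul (leqnn A) imE) _.
    rewrite mulnA leq_mul2r leq_mul2r; lia.
  - move=> I iI; exists (p j @: E); rewrite ?set11 //.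
    rewrite disjoint_subset; apply/subsetP => _ /imsetP[w wE ->].
    have [j'] := iI w wE; rewrite (size0nil js0) inE => /eqP -> //.
have bV : b <= #|V|.
  apply: leq_trans Gb; apply: leq_pmull; apply: leq_trans AG; lia.
set m := (size js).-1; have sm : size js = m.+1 by rewrite prednK.
rewrite /= sm in kN.
have kV : kap * #|V| <= b * D.
  have Vm : 0 < #|V| ^ m by rewrite expn_gt0 V0.
  rewrite -(leq_pmul2r Vm) -mulnA -expnS; apply: leq_trans kN _.
  rewrite expnS -!mulnA leq_mul2l mulnC leq_mul2l; apply/orP; right; apply/orP; right.
  by case: (m) => // m'; rewrite leq_exp2r.
pose X0 := 2 * s * b * D * A.
(* Large enough for [rich_ge], yet [h * #|V| <= 2 * X0] because [#|V| <= X0]. *)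
pose h := (X0 %/ #|V|).+1.
have h_lo : X0 <= h * #|V| by apply: ltnW; rewrite ltn_ceil.
have bX : 2 * (b * D) <= X0.
  have sA : 1 <= s * A by rewrite muln_gt0 s0.
  have -> : X0 = 2 * (b * D) * (s * A) by rewrite /X0; lia.
  exact: leq_pmulr.
have h_hi : h * #|V| <= 2 * X0.
  have VX : #|V| <= X0.
    apply: leq_trans bX; apply: leq_trans (leq_trans _ kV) _; first exact: leq_pmull.
    exact: leq_pmull.
  have := leq_divM X0 #|V|; rewrite /h mulSn; lia.
have kh : kap <= h.
  rewrite -(leq_pmul2r V0); apply: leq_trans h_lo; lia.
(* In the link, degrees are at most [h + kap <= 2 * h], with [2 * h * #|V| <= 8 * s * A * (D * b)],
   while [acc_ge] gives at least [D * b / (4 * A)] hyperedges; [A'] is the product of the two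
   factors. *)
pose A' := 32 * s * A ^ 2.
have A'0 : 0 < A' by rewrite /A' !muln_gt0 s0 A0.
have D'0 : 0 < 2 * h by [].
have cod' : codeg_le js kap.
  by move=> i i' u v Hi Hi'; apply: cod; rewrite inE ?Hi ?Hi' orbT.
have ujs' : uniq js by case/andP: ujs.
pose tl (t : b.-tuple (option V)) := pmap id t.
have stl t : size (tl t) <= b.
  by rewrite /tl size_pmap -[X in _ <= X](size_tuple t) count_size.
(* The family is chosen from the encoded sequence alone; [I] enters only afterwards, through its
   compatibility with that sequence. *)
have Ht (t : b.-tuple (option V)) : exists RR : {set {set V}},
   [/\ #|RR| <= (#|V|.+1 ^ b) ^ size js,
       forall R, R \in RR -> #|V| <= Gam * #|R| /\ R \subset W &
       forall I, indep E (j :: js) I -> valid E j js A D h (tl t) ->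
         {subset tl t <= I} ->
         (size (tl t) = b \/ size (tl t) < b /\
            {subset I :&: rich E j js A D h (acc E j js h (tl t)) <= tl t}) ->
         exists2 R, R \in RR & [disjoint R & I]].
  have [vT|nvT] := boolP (valid E j js A D h (tl t)); last first.
    by exists set0; rewrite cards0; split => // R; rewrite inE.
  set T := tl t in vT *.
  have accb : #|acc E j js h T| <= b * D.
    apply: leq_trans (acc_le js h T (fun v => dE j v (mem_head _ _))) _.
    by rewrite leq_mul2r stl orbT.
  move: (stl t); rewrite -/T leq_eqVlt => /orP[/eqP sT|sT].
    have [| | | | | | RR [RR1 RR2 RR3]] :=
      IH (acc E j js h T) A' (2 * h) js0 ujs' (ltnW sjs) cod' V0 A'0 D'0 k0.
    - move=> i v Hi; apply: leq_trans (acc_deg E h T v cod ujs Hi) _.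
      by rewrite mul2n -addnn leq_add2l.
    - move=> i w Hi /(subsetP (acc_sub _ _ _ _ _)) wE; apply: EW => //.
      by rewrite inE Hi orbT.
    - have := acc_ge vT; rewrite sT => aT.
      have : 2 * (h * #|V|) <= 8 * s * A * (4 * A * #|acc E j js h T|).
        apply: (@leq_trans (8 * s * A * (D * b))); last by rewrite leq_mul2l aT orbT.
        by move: h_hi; rewrite /X0; lia.
      by rewrite /A'; lia.
    - rewrite sm /=; rewrite -(leq_pmul2r V0).
      apply: (@leq_trans (b ^ m.+1 * D)); first by rewrite -mulnA -expnSr.
      rewrite expnSr -!mulnA leq_mul2l; apply/orP; right.
      apply: leq_trans (leq_trans _ h_lo) _; first by lia.
      by rewrite leq_pmull.
    - by [].
    - exact: Gb.
    (* The [j]-coordinate of an accumulated hyperedge lies in [T], hence in [I], so the coordinate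
       outside [I] is one of [js]. *)
    exists RR; split => // I iI _ TI _; apply: RR3 => w wE.
    have [i] := iI w (subsetP (acc_sub _ _ _ _ _) w wE).
    rewrite inE => /orP[/eqP -> |Hi wI]; last by exists i.
    by rewrite (TI _ (acc_mem wE)).
  pose X := rich E j js A D h (acc E j js h T).
  (* The set [I] meets [X] only inside [T]. Removing [T] costs at most [b] vertices, which is at
     most half of the bound [#|V| / (4 * A)] on [#|X|]. *)
  exists [set X :\: [set v in T]]; split.
  - by rewrite cards1 !expn_gt0.
  - move=> R /set1P ->; split.
      have HX : #|V| <= 4 * A * #|X|.
        by apply: (rich_ge (b := b) (s := s)) => //; apply: ltnW.
      have TX : #|X| <= #|X :\: [set v in T]| + b.
        rewrite -(cardsID [set v in T] X) addnC leq_add2l.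
        apply: leq_trans (subset_leq_card (subsetIr _ _)) _.
        by rewrite cardsE; apply: leq_trans (card_size _) (ltnW sT).
      have := leq_mul (leqnn (8 * A)) TX; rewrite mulnDr => TX'.
      have Ab : 8 * A * b <= #|V|.
        by apply: leq_trans Gb; rewrite leq_mul2r AG orbT.
      apply: (@leq_trans (8 * A * #|X :\: [set v in T]|)); first by lia.
      by rewrite leq_mul2r AG orbT.
    apply/subsetP => v; rewrite !inE => /andP[_ Dv].
    have : 0 < #|fresh E j js h (acc E j js h T) v|.
      by rewrite lt0n; apply/eqP => f0; move: Dv; rewrite f0 muln0 leqNgt D0.
    case/card_gt0P => w; rewrite inE => /and3P[wE /eqP <- _].
    by apply: EW => //; rewrite inE eqxx.
  - move=> I iI _ TI [sT'|[_ HX]]; first by rewrite sT' ltnn in sT.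
    exists (X :\: [set v in T]); rewrite ?set11 //.
    rewrite disjoint_subset; apply/subsetP => v; rewrite !inE => /andP[vT' vX].
    by apply: contra vT' => vI; apply: HX; rewrite !inE vI.
have [RR HRR] := fin_all_exists Ht.
exists (\bigcup_t RR t); split.
- apply: leq_trans (card_bigcup_le _ _) _.
  apply: (@leq_trans (\sum_(t : b.-tuple (option V)) (#|V|.+1 ^ b) ^ size js)).
    by apply: leq_sum => t _; case: (HRR t).
  by rewrite sum_nat_const card_tuple card_option expnS.
- by move=> R /bigcupP[t _ RRt]; case: (HRR t) => _ H _; apply: H.
- move=> I iI.
  have [T [vT TI HT]] := greedy_seq E j js A D h I b.
  have sT : size T <= b by case: HT => [->|[/ltnW]].
  have [t tT] := seq_pmap_tuple sT.
  case: (HRR t) => _ _ /(_ I iI); rewrite /tl tT => /(_ vT TI HT)[R R1 R2].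
  by exists R => //; apply/bigcupP; exists t.
Qed.

Definition spanned E js (C : {set V}) := [set w in E | all (fun j => p j w \in C) js].

(** While [C] spans many hyperedges, [removal_step] replaces it by at most [M] subsets, each smaller
    by at least [#|V| / Gam]. After [Gam.+1] rounds more than [#|V|] vertices would be gone. *)
Theorem containers js E A D :
    0 < size js -> uniq js -> size js <= s -> codeg_le js kap -> 0 < #|V| ->
    0 < A -> 0 < D -> 0 < kap ->
    (forall j v, j \in js -> deg E j v <= D) ->
    kap * #|V| ^ (size js).-1 <= b ^ (size js).-1 * D ->
    loss (size js) A <= Gam -> Gam * b <= #|V| ->
  exists CC : {set {set V}},
    [/\ #|CC| <= ((#|V|.+1 ^ b) ^ size js) ^ Gam.+1,
        forall C, C \in CC -> A * #|spanned E js C| < #|V| * D &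
        forall I, indep E js I -> exists2 C, C \in CC & I \subset C].
Proof.
move=> js0 ujs sjs cod V0 A0 D0 k0 dE kN lG Gb.
set M := (_ ^ b) ^ _.
pose few C := A * #|spanned E js C| < #|V| * D.
have M0 : 0 < M by rewrite /M !expn_gt0.
have G0 : 0 < Gam.
  apply: leq_trans lG; apply: leq_trans (loss_ge _ _ (leq_trans js0 sjs)); lia.
suff H n : exists CC : {set {set V}},
    [/\ #|CC| <= M ^ n,
        forall C, C \in CC -> few C \/ n * #|V| <= Gam * #|~: C| &
        forall I, indep E js I -> exists2 C, C \in CC & I \subset C].
  have [CC [C1 C2 C3]] := H Gam.+1; exists CC; split => // C /C2[] // HC.
  suff: #|~: C| <= #|V| by nia.
  exact: max_card.
elim: n => [|n [CC [C1 C2 C3]]].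
  exists [set setT]; split; first by rewrite cards1.
    by move=> C _; right.
  by move=> I _; exists setT; rewrite ?set11 ?subsetT.
have Hc C : exists CC' : {set {set V}}, [/\ #|CC'| <= M,
     C \in CC -> forall C', C' \in CC' -> few C' \/ n.+1 * #|V| <= Gam * #|~: C'| &
     forall I, indep E js I -> I \subset C -> exists2 C', C' \in CC' & I \subset C'].
  have [fC|nfC] := boolP (few C).
    exists [set C]; split; first by rewrite cards1.
      by move=> _ C' /set1P ->; left.
    by move=> I _ IC; exists C; rewrite ?set11.
  have sub : spanned E js C \subset E by apply/subsetP => w; rewrite inE => /andP[].
  have dC j v : j \in js -> deg (spanned E js C) j v <= D.
    move=> jjs; apply: leq_trans (dE j v jjs); apply: subset_leq_card.
    by apply/subsetP => w; rewrite !inE => /andP[/andP[-> _] ->].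
  have EW j w : j \in js -> w \in spanned E js C -> p j w \in C.
    by move=> jjs; rewrite inE => /andP[_ /allP/(_ j jjs)].
  have EN : #|V| * D <= A * #|spanned E js C| by rewrite leqNgt.
  have [RR [R1 R2 R3]] :=
    removal_step js0 ujs sjs cod V0 A0 D0 k0 dC EW EN kN lG Gb.
  exists [set C :\: R | R in RR]; split.
  - exact: leq_trans (leq_imset_card _ _) R1.
  - move=> CCC _ /imsetP[R RRR ->]; right.
    have [fC|nC] := C2 C CCC; first by rewrite fC in nfC.
    have [VR RC] := R2 R RRR.
    rewrite setCD (_ : #|_| = #|~: C| + #|R|); first by rewrite mulnDr mulSn addnC leq_add.
    rewrite cardsU (_ : ~: C :&: R = set0) ?cards0 ?subn0 //.
    apply/setP => v; rewrite !inE; case: (boolP (v \in R)) => vR; last by rewrite andbF.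
    by rewrite (subsetP RC _ vR).
  - move=> I iI IC.
    have [w wE|R RRR dR] := R3 I.
      by apply: iI; apply: (subsetP sub).
    exists (C :\: R); first exact: imset_f.
    apply/subsetP => v vI; rewrite inE (subsetP IC) // andbT.
    by apply: contraTN vI => vR; rewrite (disjointFr dR vR).
have [F HF] := fin_all_exists Hc.
exists (\bigcup_(C in CC) F C); split.
- apply: leq_trans (card_bigcup_le _ _) _.
  apply: (@leq_trans (\sum_(C in CC) M)).
    by apply: leq_sum => C _; case: (HF C).
  by rewrite sum_nat_const expnSr leq_mul2r C1 orbT.
- by move=> C' /bigcupP[C CCC FC]; case: (HF C) => _ H _; apply: H.
- move=> I iI; have [C CCC IC] := C3 I iI.
  case: (HF C) => _ _ /(_ I iI IC)[C' FC IC'].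
  by exists C' => //; apply/bigcupP; exists C.
Qed.

End Container.

(** * Ramsey's theorem and supersaturation *)

Lemma card_agree (A B : finType) (S : {set A}) (F : {set {ffun A -> B}}) :
    (forall f g, f \in F -> g \in F -> {in S, f =1 g}) ->
  #|F| <= #|B| ^ (#|A| - #|S|).
Proof.
move=> agr.
pose res (f : {ffun A -> B}) := [ffun a : {a | a \in ~: S} => f (val a)].
have -> : #|A| - #|S| = #|{: {a | a \in ~: S}}|.
  by rewrite -(cardsC S) addKn card_sig; apply: eq_card.
rewrite -card_ffun -(card_in_imset (f := res)); first exact: max_card.
move=> f g fF gF /ffunP fg; apply/ffunP => a.
have [aS|aS] := boolP (a \in S); first exact: agr.
have aS' : a \in ~: S by rewrite inE.
by have := fg (Sub a aS'); rewrite !ffunE.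
Qed.

(** Induction on the total of the targets: some colour [i] joins a vertex [v] to at least [k ^ m]
    others. Among these the target for [i] is lowered by one, and a clique of colour [i] extends by
    [v]. *)
Lemma ramsey (U : finType) (k : nat) (c : U -> U -> 'I_k) (s : 'I_k -> nat)
    (S : {set U}) :
    1 < k -> (forall x y, c x y = c y x) -> k ^ (\sum_i s i) <= #|S| ->
  exists i, exists T : {set U}, [/\ T \subset S, #|T| = s i &
    {in T &, forall x y, x != y -> c x y = i}].
Proof.
move=> k1 csym; move Dm: (\sum_i s i) => m.
elim: m s S Dm => [|m IH] s S Dm cS.
  exists (Ordinal (ltnW k1)), set0; split; first exact: sub0set.
    by move/eqP: Dm; rewrite sum_nat_eq0 cards0 => /forallP s0; apply/esym/eqP/s0.
  by move=> x y; rewrite inE.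
have [/existsP[i /eqP si]|/existsPn spos] := boolP [exists i, s i == 0].
  exists i, set0; split; [exact: sub0set | by rewrite si cards0 |].
  by move=> x y; rewrite inE.
have /card_gt0P[v vS] : 0 < #|S| by apply: leq_trans cS; rewrite expn_gt0 ltnW.
pose N i := [set u in S :\ v | c v u == i].
(* Otherwise [#|S| <= k * (k ^ m - 1) + 1], which is less than [k ^ m.+1] as [k > 1]. *)
have [/existsP[i Ni]|/existsPn Nlt] := boolP [exists i, k ^ m <= #|N i|]; last first.
  have : \sum_i #|N i| = #|S :\ v|.
    rewrite -sum1_card (partition_big (c v) predT) //=; apply: eq_bigr => i _.
    by rewrite -sum1_card; apply: eq_bigl => u; rewrite !inE.
  have : \sum_i #|N i| <= \sum_(i < k) (k ^ m).-1.
    by apply: leq_sum => i _; have := Nlt i; have := expn_gt0 k m; lia.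
  rewrite sum_nat_const card_ord; have := cardsD1 v S; rewrite vS.
  have : 0 < k ^ m by rewrite expn_gt0 ltnW.
  move: cS; rewrite expnS; nia.
pose s' (j : 'I_k) := if j == i then (s i).-1 else s j.
have Ds' : \sum_j s' j = m.
  have e : \sum_(j < k | j != i) s' j = \sum_(j < k | j != i) s j.
    by apply: eq_bigr => j ji; rewrite /s' (negPf ji).
  move: Dm; rewrite (bigD1 i) //= [X in X = m](bigD1 i) //= e {1}/s' eqxx.
  have := spos i; rewrite -lt0n; case: (s i) => // t _; by rewrite addSn => -[].
have [j [T [TS cT mT]]] := IH s' (N i) Ds' Ni.
have NS : N i \subset S by apply/subsetP => u; rewrite !inE -andbA => /and3P[_ ->].
have [ji|ji] := eqVneq j i; last first.
  exists j, T; split => //; first exact: subset_trans TS NS.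
  by rewrite cT /s' (negPf ji).
rewrite ji in cT mT.
have TN u : u \in T -> [/\ u != v, u \in S & c v u = i].
  by move/(subsetP TS); rewrite !inE -andbA => /and3P[-> -> /eqP].
exists i, (v |: T); split.
- apply/subsetP => u /setU1P[->|/TN[]] //.
- rewrite cardsU1 cT /s' eqxx.
  have -> : v \notin T by apply/negP => /TN[]; rewrite eqxx.
  by rewrite add1n prednK // lt0n spos.
- move=> x y /setU1P[->|xT] /setU1P[->|yT]; rewrite ?eqxx //.
  + by case: (TN y yT).
  + by rewrite csym; case: (TN x xT).
  + exact: mT.
Qed.

(** * The hypergraph of potential monochromatic copies of [H] *)

Section Hypergraph.

Variables (H : sgraph) (k n : nat).
Hypothesis k_gt1 : 1 < k.

Definition emb := ({ffun H -> 'I_n} * 'I_k)%type.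
Definition slot := ('I_n * 'I_n * option 'I_k)%type.
Implicit Type C : {set slot}.

(** The hyperedge [w] is a placement of [H] with a colour; its vertices are the slots a coloured
    graph must have for this placement to be an induced monochromatic copy. *)
Definition coord (j : H * H) (w : emb) : slot :=
  (w.1 j.1, w.1 j.2, if adj j.1 j.2 then Some w.2 else None).

(* Each unordered pair of vertices of [H] is listed once: listing both orders
   would make the codegree of the two coordinates as large as a degree. *)
Definition coords : seq (H * H) :=
  [seq j <- enum {: H * H} | enum_rank j.1 < enum_rank j.2].

Definition embs : {set emb} := [set w : emb | injectiveb w.1].

Lemma mem_coords a b : ((a, b) \in coords) = (enum_rank a < enum_rank b).
Proof. by rewrite mem_filter mem_enum andbT. Qed.

Lemma uniq_coords : uniq coords.
Proof. by rewrite filter_uniq ?enum_uniq. Qed.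

Lemma card_slot : #|{: slot}| = n * n * k.+1.
Proof. by rewrite !card_prod card_option !card_ord. Qed.

Lemma card_emb_agree (S : {set H}) (F : {set emb}) :
    (forall v w, v \in F -> w \in F -> {in S, v.1 =1 w.1}) ->
  #|F| <= k * n ^ (#|H| - #|S|).
Proof.
move=> agr; have sub : F \subset setX [set w.1 | w in F] setT.
  by apply/subsetP => w wF; rewrite !inE andbT; apply: imset_f.
apply: leq_trans (subset_leq_card sub) _.
rewrite cardsX cardsT card_ord mulnC leq_mul2l; apply/orP; right.
rewrite -[X in X ^ _](card_ord n); apply: card_agree.
by move=> f g /imsetP[v vF ->] /imsetP[w wF ->]; apply: agr.
Qed.

Lemma coord_deg E j v : j \in coords -> deg coord E j v <= k * n ^ (#|H| - 2).
Proof.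
case: j => a b; rewrite mem_coords => ab.
have ba : a != b by apply: contraTneq ab => ->; rewrite ltnn.
have -> : 2 = #|[set a; b]| by rewrite cards2 ba.
apply: card_emb_agree => x y; rewrite !inE => /andP[_ /eqP <-] /andP[_ /eqP[]].
by move=> ea eb _ c /set2P[] ->.
Qed.

(** Two distinct listed pairs cover at least three vertices of [H], since the ranks exclude reversed
    pairs; the two slots fix the images of these vertices. *)
Lemma coord_codeg : 0 < n -> codeg_le coord coords (k * n ^ (#|H| - 3)).
Proof.
move=> n0 [a b] [c d] u v; rewrite !mem_coords => ab cd abcd.
pose S := [set a; b] :|: [set c; d].
have nab : a != b by apply: contraTneq ab => ->; rewrite ltnn.
have ncd : c != d by apply: contraTneq cd => ->; rewrite ltnn.
have S3 : 3 <= #|S|.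
  have [cab|ncab] := boolP (c \in [set a; b]); last first.
    apply: leq_trans (subset_leq_card (A := mem (c |: [set a; b])) _).
      by rewrite cardsU1 ncab cards2 nab.
    by apply/subsetP => x /setU1P[->|xS]; [rewrite !inE eqxx ?orbT | rewrite inE xS].
  have ndab : d \notin [set a; b].
    apply/negP => dab; move: cab dab ab cd ncd abcd.
    by rewrite !inE => /orP[]/eqP-> /orP[]/eqP->; rewrite ?eqxx //; lia.
  apply: leq_trans (subset_leq_card (A := mem (d |: [set a; b])) _).
    by rewrite cardsU1 ndab cards2 nab.
  by apply/subsetP => x /setU1P[->|xS]; [rewrite !inE eqxx ?orbT | rewrite inE xS].
have Sn : #|S| <= #|H| by apply: max_card.
apply: (@leq_trans (k * n ^ (#|H| - #|S|))); last first.
  rewrite leq_mul2l; apply/orP; right.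
  by rewrite leq_pexp2l // leq_sub2l.
apply: card_emb_agree => x y; rewrite !inE.
case/andP => /eqP <- /eqP <- /andP[/eqP[ea eb _] /eqP[ec ed _]] e.
by rewrite !inE -orbA => /or4P[] /eqP ->.
Qed.

Definition both C x y o := ((x, y, o) \in C) && ((y, x, o) \in C).
(* The two orders of a pair must be tested together, since a container of a
   symmetric set need not be symmetric. *)
Definition free C x y :=
  [&& x != y, both C x y None & [exists i, both C x y (Some i)]].
Definition nonfree C : {set 'I_n * 'I_n} := [set e | ~~ free C e.1 e.2].

Lemma both_sym C x y o : both C x y o = both C y x o.
Proof. exact: andbC. Qed.

(** At least half of the maps [y] from [r] points to [n] vertices have only free pairs, by a union
    bound over pairs of points. Each such [y] contains a spanned copy by [ramsey], and a copy with a
    prescribed position among the [r] points lies in at most [n ^ (r - h)] maps. *)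
Lemma supersaturation C (r := k ^ (k * #|H|)) : 0 < n -> 0 < #|H| ->
    2 * r ^ 2 * #|nonfree C| <= n ^ 2 ->
  n ^ #|H| <= 2 * r ^ #|H| * #|spanned coord embs coords C|.
Proof.
move=> n0 H0 NF; set h := #|H| in H0 *.
have hr : h <= r.
  apply: leq_trans (ltnW (ltn_expl _ k_gt1)).
  by rewrite leq_pmull // ltnW.
have r2 : 2 <= r.
  rewrite /r -[2]expn1; apply: (@leq_trans (k ^ 1)); first by rewrite leq_exp2r.
  by rewrite leq_exp2l // muln_gt0 H0 ltnW.
pose Y := [set y : {ffun 'I_r -> 'I_n} |
             [forall a, forall b, (a != b) ==> free C (y a) (y b)]].
have Yc : 2 * #|~: Y| <= n ^ r.
  pose B (ab : 'I_r * 'I_r) := [set y : {ffun 'I_r -> 'I_n} |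
     (ab.1 != ab.2) && ((y ab.1, y ab.2) \in nonfree C)].
  have sub : ~: Y \subset \bigcup_ab B ab.
    apply/subsetP => y; rewrite !inE negb_forall => /existsP[a].
    rewrite negb_forall => /existsP[b]; rewrite negb_imply => /andP[ab nf].
    by apply/bigcupP; exists (a, b) => //; rewrite !inE ab nf.
  have BB ab : #|B ab| <= #|nonfree C| * n ^ (r - 2).
    case: ab => a b; have [ab|ab] := eqVneq a b.
      rewrite (_ : B _ = set0) ?cards0 //; apply/setP => y.
      by rewrite !inE /= ab eqxx.
    rewrite -sum1_card (partition_big (fun y : {ffun 'I_r -> 'I_n} => (y a, y b))
      (mem (nonfree C))) /=; last first.
      by move=> y; rewrite inE => /andP[].
    rewrite -sum_nat_const; apply: leq_sum => e _; rewrite sum1_card -cardsE.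
    have -> : n ^ (r - 2) = #|'I_n| ^ (#|'I_r| - #|[set a; b]|).
      by rewrite !card_ord cards2 ab.
    apply: card_agree => f g; rewrite !inE => /andP[_ /eqP <-] /andP[_ /eqP[ea eb]].
    by move=> c /set2P[] ->.
  apply: (@leq_trans (2 * (r ^ 2 * (#|nonfree C| * n ^ (r - 2))))).
    rewrite leq_mul2l /=; apply: leq_trans (subset_leq_card sub) _.
    apply: leq_trans (card_bigcup_le _ _) _.
    apply: (@leq_trans (\sum_(ab : 'I_r * 'I_r) (#|nonfree C| * n ^ (r - 2)))).
      by apply: leq_sum => ab _; apply: BB.
    by rewrite sum_nat_const card_prod card_ord.
  apply: (@leq_trans (2 * r ^ 2 * #|nonfree C| * n ^ (r - 2))); first by rewrite !mulnA.
  apply: leq_trans (leq_mul NF (leqnn _)) _.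
  by rewrite -expnD subnKC.
have YY : n ^ r <= 2 * #|Y|.
  have := cardsC Y; rewrite card_ffun !card_ord; lia.
pose Z (z : {ffun H -> 'I_r} * emb) := [set y : {ffun 'I_r -> 'I_n} |
   injectiveb z.1 & [forall a, y (z.1 a) == z.2.1 a]].
have ZZ z : #|Z z| <= n ^ (r - h).
  have [inj|ninj] := boolP (injectiveb z.1); last first.
    by rewrite (_ : Z z = set0) ?cards0 //; apply/setP => y; rewrite !inE (negPf ninj).
  have -> : n ^ (r - h) = #|'I_n| ^ (#|'I_r| - #|[set z.1 a | a in H]|).
    by rewrite card_imset ?card_ord //; apply/injectiveP.
  apply: card_agree => f g; rewrite !inE => /andP[_ /forallP fz] /andP[_ /forallP gz].
  by move=> _ /imsetP[a _ ->]; rewrite (eqP (fz a)) (eqP (gz a)).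
have cov : Y \subset \bigcup_(z in setX setT (spanned coord embs coords C)) Z z.
  apply/subsetP => y; rewrite inE => /forallP yf.
  have {}yf a b : a != b -> free C (y a) (y b) by move/forallP: (yf a) => /(_ b)/implyP.
  (* Some colour allowed by [C] is picked; the default can occur only for [a = b]. *)
  pose c a b := odflt (Ordinal (ltnW k_gt1)) [pick i | both C (y a) (y b) (Some i)].
  have csym a b : c a b = c b a.
    by rewrite /c; congr odflt; apply: eq_pick => i; apply: both_sym.
  have cP a b : a != b -> both C (y a) (y b) (Some (c a b)).
    move/yf => /and3P[_ _ /existsP[i bi]]; rewrite /c.
    by case: pickP => [//|/(_ i)]; rewrite bi.
  have [|i [T [_ cT mT]]] := @ramsey _ _ c (fun=> h) setT k_gt1 csym.
    by rewrite sum_nat_const cardsT !card_ord.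
  pose e := [ffun a : H => enum_val (cast_ord (esym cT) (enum_rank a))].
  have einj : injective e.
    by move=> a b; rewrite !ffunE => /enum_val_inj/cast_ord_inj/enum_rank_inj.
  have eT a : e a \in T by rewrite ffunE enum_valP.
  have ec a b : a != b -> c (e a) (e b) = i.
    by move=> ab; apply: mT => //; rewrite (inj_eq einj).
  pose x := [ffun a => y (e a)].
  have xf a b : a != b -> free C (x a) (x b).
    by move=> ab; rewrite [x a]ffunE [x b]ffunE; apply: yf; rewrite (inj_eq einj).
  apply/bigcupP; exists (e, (x, i)); last first.
    rewrite !inE /=; apply/andP; split; first exact/injectiveP.
    by apply/forallP => a; rewrite !ffunE.
  rewrite !inE /=; apply/andP; split.
    apply/injectiveP => a b; apply: contra_eq => /xf /and3P[] //.
  apply/allP => -[a b]; rewrite mem_coords => ab.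
  have nab : a != b by apply: contraTneq ab => ->; rewrite ltnn.
  (* Freeness supplies the non-edges of [H], and the clique [T] its edges in colour [i]. *)
  rewrite /coord /=; case: ifP => _; last by case/and3P: (xf a b nab) => _ /andP[].
  have := @cP (e a) (e b); rewrite (inj_eq einj) ec // => /(_ nab)/andP[].
  by rewrite !ffunE.
have nr0 : 0 < n ^ (r - h) by rewrite expn_gt0 n0.
rewrite -(leq_pmul2r nr0) -expnD subnKC //; apply: leq_trans YY _.
rewrite -!mulnA leq_mul2l /=; apply: leq_trans (subset_leq_card cov) _.
apply: leq_trans (card_bigcup_le _ _) _.
apply: (@leq_trans (\sum_(z in setX setT (spanned coord embs coords C)) n ^ (r - h))).
  by apply: leq_sum => z _; apply: ZZ.
by rewrite sum_nat_const cardsX cardsT card_ffun card_ord -mulnA.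
Qed.

End Hypergraph.

(** * Counting graphs without the arrow property *)

Section Status.

Variables (G : sgraph) (k : nat) (c : edge G -> 'I_k).

Lemma mem_edges (x y : G) : ([set x; y] \in edges G) = adj x y.
Proof.
apply/imsetP/idP => [[[u v]]|xy]; last by exists (x, y); rewrite ?inE.
rewrite inE /= => uv exy.
have nuv : u != v by apply: contraTneq uv => ->; rewrite adj_irr.
have : u \in [set x; y] by rewrite exy set21.
have : v \in [set x; y] by rewrite exy set22.
move=> /set2P[] ev /set2P[] eu; move: uv nuv; rewrite ev eu ?eqxx //.
by rewrite adj_sym.
Qed.

Definition status (x y : G) : option 'I_k := omap c (insub [set x; y]).

Lemma status_sym x y : status x y = status y x.
Proof. by rewrite /status setUC. Qed.

Lemma status_adj x y : isSome (status x y) = adj x y.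
Proof. by rewrite /status; case: insubP => [e|/negPf]; rewrite mem_edges. Qed.

End Status.

Section Transfer.

Variables (H G : sgraph) (k : nat).
Variables (c : edge G -> 'I_k) (x : H -> G) (i : 'I_k).
Hypotheses (x_inj : injective x)
  (x_stat : forall a b, a != b ->
     status c (x a) (x b) = if adj a b then Some i else None).

(** A status records adjacency as well as colour, so [x_stat] makes the copy induced and all its
    edges of colour [i]. *)
Lemma status_copy : exists2 S : {set G}, isomorphic (induced S) H & monochromatic c S.
Proof.
have xadj a b : adj (x a) (x b) = adj a b.
  have [->|ab] := eqVneq a b; first by rewrite !adj_irr.
  by rewrite -(status_adj c) x_stat //; case: ifP.
exists [set x a | a : H].
  have xS a : x a \in [set x a | a : H] by apply: imset_f.
  pose g a : induced [set x a | a : H] := Sub (x a) (xS a).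
  have g_inj : injective g by move=> a b /(congr1 val) /=; apply: x_inj.
  have [f gK fK] : bijective g.
    apply: inj_card_bij => //.
    by rewrite card_sig (card_imset predT x_inj).
  exists f; first by exists g.
  by move=> u v; rewrite -{2}[u]fK -{2}[v]fK; rewrite /= /induced_adj /= xadj.
suff Hi (e : edge G) : val e \subset [set x a | a : H] -> c e = i.
  by move=> e e' /Hi -> /Hi ->.
move=> eS; have /imsetP[[u v]] := valP e; rewrite inE /= => uv.
rewrite -[sval e]/(val e) => euv.
have /imsetP[a _ ua] : u \in [set x a | a : H] by apply: (subsetP eS); rewrite euv set21.
have /imsetP[b _ vb] : v \in [set x a | a : H] by apply: (subsetP eS); rewrite euv set22.
have ab : a != b.
  by apply: contraTneq uv => ab; rewrite ua vb ab adj_irr.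
have := x_stat ab; rewrite -xadj -ua -vb uv /status -euv valK /=.
by case.
Qed.

End Transfer.

(** * Random graphs and the union bound over containers *)

Section RandomGraph.

Variable n : nat.
Implicit Type g : {set 'I_n * 'I_n}.

(** Every graph on ['I_n] is coded by equally many sets [g], so counting sets amounts to the uniform
    measure on graphs. *)
Definition gadj g : rel 'I_n := fun x y =>
  ((x < y) && ((x, y) \in g)) || ((y < x) && ((y, x) \in g)).

Lemma gadj_sym g : symmetric (gadj g).
Proof. by move=> x y; rewrite /gadj orbC. Qed.

Lemma gadj_irr g : irreflexive (gadj g).
Proof. by move=> x; rewrite /gadj ltnn. Qed.

Definition graph_of g : sgraph := SGraph (@gadj_sym g) (@gadj_irr g).

Lemma graph_of_adj g (x y : 'I_n) : x < y -> @adj (graph_of g) x y = ((x, y) \in g).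
Proof. by move=> xy; rewrite /= /gadj xy ltnNge (ltnW xy) orbF. Qed.

Variables (H : sgraph) (k : nat).
Hypothesis k_gt1 : 1 < k.

Definition stat g (c : edge (graph_of g) -> 'I_k) : {set slot k n} :=
  [set t | @status (graph_of g) k c t.1.1 t.1.2 == t.2].

Lemma stat_indep g (c : edge (graph_of g) -> 'I_k) :
    ~ (exists2 S : {set graph_of g}, isomorphic (induced S) H & monochromatic c S) ->
  indep (@coord H k n) (@embs H k n) (coords H) (stat c).
Proof.
move=> nS [x i]; rewrite inE /= => /injectiveP xinj.
have [/allP Hall|/allPn[j]] :=
  boolP (all (fun j => coord j (x, i) \in stat c) (coords H)); last by exists j.
case: nS; apply: (@status_copy H (graph_of g) k c x i xinj).
have lt a b : enum_rank a < enum_rank b ->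
    @status (graph_of g) k c (x a) (x b) = if adj a b then Some i else None.
  by rewrite -mem_coords => /Hall; rewrite inE /= => /eqP.
move=> a b ab; case: (ltngtP (enum_rank a) (enum_rank b)) =>
  [/lt //|ba|/ord_inj/enum_rank_inj abE].
- by rewrite status_sym lt // adj_sym.
- by rewrite abE eqxx in ab.
Qed.

Definition forced (C : {set slot k n}) := [set e in nonfree C | e.1 < e.2].

Lemma card_nonfree C : #|nonfree C| <= n + 2 * #|forced C|.
Proof.
pose sw (e : 'I_n * 'I_n) := (e.2, e.1).
have sub : nonfree C \subset
    [set (x, x) | x : 'I_n] :|: (forced C :|: [set sw e | e in forced C]).
  apply/subsetP => -[x y] xy; case: (ltngtP x y) => [lt|gt|/ord_inj ->].
  - by rewrite !inE lt /= in xy *; rewrite xy orbT.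
  - have yx : (y, x) \in forced C.
      move: xy; rewrite !inE gt andbT /= /free eq_sym both_sym.
      by under eq_existsb => i do rewrite both_sym.
    by rewrite !inE (_ : (x, y) = sw (y, x)) // (imset_f sw yx) !orbT.
  - by rewrite inE imset_f.
apply: leq_trans (subset_leq_card sub) _.
apply: leq_trans (leq_card_setU _ _) _; apply: leq_add.
  by apply: leq_trans (leq_imset_card _ _) _; rewrite card_ord.
apply: leq_trans (leq_card_setU _ _) _; rewrite mul2n -addnn leq_add2l.
exact: leq_imset_card.
Qed.

(** The true status of [e] is allowed by [C] in both orders. Since [e] is not free, either [None] is
    excluded and [e] is an edge, or every colour is excluded and it is not. *)
Lemma forcedP g (c : edge (graph_of g) -> 'I_k) (C : {set slot k n}) e :
  stat c \subset C -> e \in forced C -> (e \in g) = ~~ both C e.1 e.2 None.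
Proof.
case: e => x y /subsetP sC; rewrite !inE /= => /andP[nf xy].
rewrite -graph_of_adj // -(status_adj c).
have stC : both C x y (@status (graph_of g) k c x y).
  by rewrite /both !sC // inE /= // status_sym.
have nxy : x != y by apply: contraTneq xy => ->; rewrite ltnn.
rewrite /free nxy /= negb_and in nf.
case Es: (status _ _ _) => [i|] in stC *; last by rewrite stC.
case/orP: nf => // /existsPn/(_ i); by rewrite stC.
Qed.

Lemma card_forced (F : {set {set 'I_n * 'I_n}}) (Z : {set 'I_n * 'I_n}) :
    (forall g g' e, g \in F -> g' \in F -> e \in Z -> (e \in g) = (e \in g')) ->
  #|F| <= 2 ^ (n ^ 2 - #|Z|).
Proof.
move=> FZ; rewrite -(card_in_imset (f := fun g => g :\: Z)).
  have -> : n ^ 2 - #|Z| = #|~: Z|.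
    by have := cardsC Z; rewrite card_prod card_ord -mulnn => <-; rewrite addKn.
  rewrite -card_powerset; apply: subset_leq_card; apply/subsetP.
  by move=> _ /imsetP[g _ ->]; rewrite powersetE subsetDr.
move=> g g' gF g'F /setP eg; apply/setP => e.
have [eZ|eZ] := boolP (e \in Z); first exact: FZ.
by have := eg e; rewrite !inE eZ.
Qed.

(** If every graph fails, each [g] has a bad colouring covered by one of at most [2 ^ z] containers.
    A container forces more than [z] pairs, so it serves at most [2 ^ (n ^ 2 - z.+1)] sets [g], too
    few in total. *)
Theorem ind_arrow_exists (s := size (coords H)) (r := k ^ (k * #|H|))
    (A := 2 * (k * k.+1) * r ^ #|H|) (N := n * n * k.+1) (b Gam L : nat) :
    0 < n -> 0 < s -> loss s s A <= Gam -> Gam * b <= N ->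
    k * n ^ (#|H| - 3) * N ^ s.-1 <= b ^ s.-1 * (k * n ^ (#|H| - 2)) ->
    4 * r ^ 2 <= n -> N < 2 ^ L -> 8 * r ^ 2 * (L * b * s * Gam.+1) <= n ^ 2 ->
  exists2 G : sgraph, ind_arrow G H k & #|G| = n.
Proof.
move=> n0 s0 lG Gb kN rn NL Ln.
have k0 : 0 < k by apply: ltnW.
have r0 : 0 < r by rewrite expn_gt0 k0.
have [g|none] := classic (exists g, ind_arrow (graph_of g) H k).
  by case: g => g Hg; exists (graph_of g) => //; rewrite /= card_ord.
have Hg g : exists I : {set slot k n},
    indep (@coord H k n) (@embs H k n) (coords H) I /\ exists c, I = @stat g c.
  have ng : ~ ind_arrow (graph_of g) H k by move=> ar; apply: none; exists g.
  have [c nc] := not_all_ex_not _ _ ng.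
  by exists (stat c); split; [apply: stat_indep | exists c].
have {Hg}[I HI] := fin_all_exists Hg.
have H2 : 2 <= #|H|.
  move: s0; rewrite /s; case E: (coords H) => [//|[a d] l] _.
  have := mem_head (a, d) l; rewrite -E mem_coords => ad.
  apply: leq_trans (ltn_ord (enum_rank d)); rewrite ltnS.
  exact: leq_ltn_trans (leq0n _) ad.
have A0 : 0 < A by rewrite /A !muln_gt0 k0 expn_gt0 r0.
have N0 : 0 < N by rewrite /N !muln_gt0 n0.
have VN : #|{: slot k n}| = N := card_slot k n.
have [] := @containers _ _ _ (@coord H k n) s b (k * n ^ (#|H| - 3)) Gam (coords H)
  (@embs H k n) A (k * n ^ (#|H| - 2)) => //; rewrite ?VN //.
- exact: uniq_coords.
- exact: coord_codeg.
- by rewrite muln_gt0 k0 expn_gt0 n0.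
- by rewrite muln_gt0 k0 expn_gt0 n0.
- by move=> j v; apply: coord_deg.
move=> CC [C1 C2 C3].
pose z := L * b * s * Gam.+1.
have Zbig C : C \in CC -> z < #|forced C|.
  move=> /C2 few.
  (* The container bound compares with [k * k.+1 * n ^ #|H|], so the choice of [A] makes it
     contradict the conclusion of [supersaturation]. *)
  have NF : n ^ 2 < 2 * r ^ 2 * #|nonfree C|.
    rewrite ltnNge; apply/negP => /(supersaturation k_gt1 n0 (ltnW H2)).
    move=> /(leq_mul (leqnn (k * k.+1))).
    have -> : n ^ #|H| = n * n * n ^ (#|H| - 2) by rewrite mulnn -expnD subnKC.
    move: few; rewrite /A /N -/r; lia.
  (* By [rn] the diagonal accounts for at most [n ^ 2 / 2], whence
     [n ^ 2 < 8 * r ^ 2 * #|forced C|]. *)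
  have := leq_mul (leqnn (2 * r ^ 2)) (card_nonfree C).
  move: NF Ln rn; rewrite -/z; nia.
have cov : [set: {set 'I_n * 'I_n}] \subset \bigcup_(C in CC) [set g | I g \subset C].
  apply/subsetP => g _; have [iI _] := HI g.
  by have [C CCC IC] := C3 _ iI; apply/bigcupP; exists C; rewrite ?inE.
have := subset_leq_card cov; rewrite leqNgt => /negP[].
apply: leq_ltn_trans (card_bigcup_le _ _) _.
apply: (@leq_ltn_trans (\sum_(C in CC) 2 ^ (n ^ 2 - z.+1))).
  apply: leq_sum => C CCC.
  apply: (@leq_trans (2 ^ (n ^ 2 - #|forced C|))); last first.
    by rewrite leq_exp2l // leq_sub2l // Zbig.
  apply: card_forced => g g' e gC g'C eZ; rewrite inE in gC; rewrite inE in g'C.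
  have [_ [c Ec]] := HI g; have [_ [c' Ec']] := HI g'.
  rewrite Ec in gC; rewrite Ec' in g'C.
  by rewrite (forcedP gC eZ) (forcedP g'C eZ).
rewrite sum_nat_const -powersetT card_powerset cardsT card_prod card_ord mulnn.
(* This makes the truncated subtraction in the exponent exact. *)
have zn : z.+1 <= n ^ 2.
  have [C0|/card_gt0P[C CCC]] := posnP #|CC|.
    have [iI _] := HI set0; have [C CCC _] := C3 _ iI.
    by have := card0_eq C0 C; rewrite CCC.
  apply: leq_trans (Zbig C CCC) _; apply: leq_trans (max_card _) _.
  by rewrite card_prod card_ord.
apply: (@leq_ltn_trans (2 ^ z * 2 ^ (n ^ 2 - z.+1))).
  rewrite leq_mul2r; apply/orP; right; apply: leq_trans C1 _.
  rewrite /z !expnM -/s.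
  have e2 m m' e : m <= m' -> m ^ e <= m' ^ e by case: e => // e mm'; rewrite leq_exp2r.
  by do 3! apply: (e2).
rewrite -expnD ltn_exp2l //; lia.
Qed.

End RandomGraph.

(** * Choice of the order of the graph *)

(** The class [k ^ O(k)]; its closure properties let the bound on [order] be read off from the
    formula. *)
Definition selfexp_bounded (f : nat -> nat) :=
  exists c, forall k, 1 < k -> f k <= k ^ (c * k).

Lemma selfexp_bounded_le f g : (forall k, 1 < k -> f k <= g k) ->
  selfexp_bounded g -> selfexp_bounded f.
Proof. by move=> fg [c gc]; exists c => k k1; apply: leq_trans (fg k k1) (gc k k1). Qed.

Lemma selfexp_bounded_const m : selfexp_bounded (fun=> m).
Proof.
exists m => k k1; apply: leq_trans (ltnW (ltn_expl m k1)) _.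
by rewrite leq_exp2l // leq_pmulr // ltnW.
Qed.

Lemma selfexp_boundedM f g : selfexp_bounded f -> selfexp_bounded g ->
  selfexp_bounded (fun k => f k * g k).
Proof.
move=> [c fc] [d gd]; exists (c + d) => k k1.
by rewrite mulnDl expnD leq_mul ?fc ?gd.
Qed.

Lemma selfexp_boundedX f m : selfexp_bounded f -> selfexp_bounded (fun k => f k ^ m).
Proof.
move=> bf; elim: m => [|m IH]; first exact: (selfexp_bounded_const 1).
apply: selfexp_bounded_le (selfexp_boundedM bf IH) => k _; by rewrite expnS.
Qed.

Lemma selfexp_boundedS f : selfexp_bounded f -> selfexp_bounded (fun k => (f k).+1).
Proof.
case=> c fc; exists c.+1 => k k1.
rewrite mulSn expnD; have := fc k k1.
have : 2 <= k ^ k.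
  by apply: (leq_trans k1); rewrite -{1}(expn1 k) leq_exp2l // ltnW.
have : 0 < k ^ (c * k) by rewrite expn_gt0 ltnW.
move: (k ^ k) (k ^ (c * k)) => u v; nia.
Qed.

Lemma selfexp_bounded_id : selfexp_bounded id.
Proof. by exists 1 => k k1; rewrite mul1n ltnW // ltn_expl. Qed.

Lemma selfexp_bounded_loss s m f : selfexp_bounded f ->
  selfexp_bounded (fun k => loss s m (f k)).
Proof.
elim: m f => [|m IH] f bf /=.
  by apply: selfexp_boundedM => //; apply: selfexp_bounded_const.
apply: (IH (fun k => 32 * s * f k ^ 2)).
by apply: selfexp_boundedM; [apply: selfexp_bounded_const | apply: selfexp_boundedX].
Qed.

Lemma ind_ramsey_le (H G : sgraph) k : ind_arrow G H k ->
  exists2 r, is_ind_ramsey H k r & r <= #|G|.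
Proof.
move Dm: #|G| => m; elim/ltn_ind: m G Dm => m IH G Dm GH.
have [[G' [G'H lt]]|min] := classic (exists G' : sgraph, ind_arrow G' H k /\ #|G'| < m).
  have [r Hr rle] := IH _ lt G' erefl G'H.
  by exists r => //; apply: leq_trans rle (ltnW lt).
exists m => //; split; first by exists G.
by move=> G' G'H; rewrite leqNgt; apply/negP => lt; apply: min; exists G'.
Qed.

(** Without listed pairs [H] has at most one vertex, hence no edge to colour. *)
Lemma ind_arrow_trivial (H : sgraph) k : coords H = [::] -> ind_arrow H H k.
Proof.
move=> cH c; exists setT.
  exists val; last by [].
  apply: inj_card_bij; first exact: val_inj.
  by rewrite card_sig; apply: subset_leq_card; apply/subsetP => x _; rewrite !inE.
move=> e; have /imsetP[[u v]] := valP e; rewrite inE /= => uv _.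
have nuv : u != v by apply: contraTneq uv => ->; rewrite adj_irr.
have no (a b : H) : (enum_rank a < enum_rank b) = false by rewrite -mem_coords cH.
by case: (ltngtP (enum_rank u) (enum_rank v)) (no u v) (no v u) => // /ord_inj/enum_rank_inj uvE;
  rewrite uvE eqxx in nuv.
Qed.

Section Order.

Variable H : sgraph.
Let h := #|H|.
Let s := size (coords H).

Definition ramsey_bound k := k ^ (k * h).
Definition density k := 2 * (k * k.+1) * ramsey_bound k ^ h.
Definition shrink k := loss s s (density k).
Definition scale k := 64 * s * s.+1 * ramsey_bound k ^ 2 * (shrink k).+1 * k.+1.
(** With [q = scale k ^ 3], the codegree condition reads [(k.+1 * q) ^ s.-1 <= n], which suggests
    this power. The cube leaves room for the factor [L], linear in [scale k]. *)
Definition order k := (k.+1 * scale k ^ 3) ^ s.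

Lemma selfexp_bounded_order : selfexp_bounded order.
Proof.
have bk := selfexp_boundedS selfexp_bounded_id.
have br : selfexp_bounded ramsey_bound by exists h => k _; rewrite mulnC.
have bs : selfexp_bounded shrink.
  apply: selfexp_bounded_loss.
  by do ![apply: selfexp_boundedM | apply: selfexp_boundedX
        | exact: selfexp_bounded_const | exact: selfexp_bounded_id].
apply: selfexp_boundedX; apply: selfexp_boundedM => //; apply: selfexp_boundedX.
apply: selfexp_boundedM => //; apply: selfexp_boundedM; last exact: selfexp_boundedS.
by apply: selfexp_boundedM; [apply: selfexp_bounded_const | apply: selfexp_boundedX].
Qed.

(** For [h <= 2] the truncated exponents [h - 2] and [h - 3] coincide; the codegree condition then
    holds because [s.-1 = 0]. *)
Lemma size_coords_le1 : h <= 2 -> s <= 1.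
Proof.
rewrite /s => h2; case E: (coords H) => [//|x l].
rewrite -E -[1]/(size [:: x]); apply: uniq_leq_size; first exact: uniq_coords.
have xc : x \in coords H by rewrite E mem_head.
case: x xc {E} => a b; rewrite mem_coords => ab [c d]; rewrite mem_coords inE => cd.
have r2 (u : H) : enum_rank u < 2 by apply: leq_trans (ltn_ord _) h2.
have [d2 b2] := (r2 d, r2 b).
by apply/eqP; congr pair; apply/enum_rank_inj/ord_inj; lia.
Qed.

Lemma ind_arrow_order k : 1 < k -> 0 < s ->
  exists2 G : sgraph, ind_arrow G H k & #|G| = order k.
Proof.
move=> k1 s0; have k0 := ltnW k1.
set r := ramsey_bound k; set Gam := shrink k; set P := scale k.
have r0 : 0 < r by rewrite expn_gt0 k0.
have r20 : 0 < r ^ 2 by rewrite expn_gt0 r0.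
have HP : 64 * s * s.+1 * r ^ 2 * Gam.+1 <= P.
  by rewrite /P /scale -/r -/Gam leq_pmulr.
have kP : k.+1 <= P.
  by rewrite /P /scale leq_pmull // !muln_gt0 s0 r0.
have P0 : 0 < P by apply: leq_trans kP.
have rP : 4 * r ^ 2 <= P.
  apply: leq_trans HP; have : 1 <= s * s.+1 * Gam.+1 by rewrite !muln_gt0 s0.
  by move: (r ^ 2) r20 => R; nia.
have GP : Gam <= P.
  apply: leq_trans HP; have : 1 <= s * s.+1 * r ^ 2 by rewrite !muln_gt0 s0 r0.
  nia.
set q := P ^ 3.
have Pq : P <= q by rewrite /q -{1}(expn1 P) leq_pexp2l.
have q0 : 0 < q by apply: leq_trans Pq.
set n := order k; have En : n = (k.+1 * q) ^ s by [].
clearbody n P.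
pose n' := k.+1 * (k.+1 * q) ^ s.-1.
have nq : n = n' * q.
  by rewrite En -(prednK s0) expnS /n'; lia.
have n0 : 0 < n by rewrite En expn_gt0 muln_gt0 q0.
have qn : q <= n by rewrite nq leq_pmull // /n' muln_gt0 expn_gt0 muln_gt0 q0.
(* This is the number of slots divided by [k.+1 * q]. *)
pose b := n * n'.
have bq : n * n = b * q by rewrite /b {2}nq mulnA.
(* The number of slots is at most [P ^ (4 * (2 * s + 1))], and [P < 2 ^ P]; this gives the value of
   [L]. *)
apply: (@ind_arrow_exists n H k k1 b Gam (8 * s.+1 * P)) => //.
- rewrite bq; apply: (@leq_trans (q * b)); first by rewrite leq_mul2r (leq_trans GP Pq) orbT.
  by rewrite [q * b]mulnC leq_pmulr.
- rewrite -/s -/h bq -mulnA [b ^ _ * _]mulnCA leq_mul2l; apply/orP; right.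
  have -> : b * q * k.+1 = b * (k.+1 * q) by lia.
  rewrite expnMn mulnCA leq_mul2l; apply/orP; right.
  have [h2|h3] := leqP h 2.
    have -> : s.-1 = 0 by have := size_coords_le1 h2; rewrite -/s; lia.
    by rewrite muln1 leq_pexp2l // leq_sub2l.
  have -> : h - 2 = (h - 3).+1 by lia.
  rewrite [n ^ _.+1]expnSr leq_mul2l; apply/orP; right.
  by rewrite En leq_pexp2l ?leq_pred // muln_gt0 q0.
- by apply: leq_trans rP (leq_trans Pq qn).
- have kqP : k.+1 * q <= P ^ 4 by rewrite expnS leq_mul2r kP orbT.
  apply: (@leq_ltn_trans ((k.+1 * q) ^ (s + s).+1)).
    rewrite expnSr expnD -En leq_mul2l; apply/orP; right; exact: leq_pmulr.
  apply: (@leq_ltn_trans ((P ^ 4) ^ (s + s).+1)); first by rewrite leq_exp2r.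
  have PX m : 0 < m -> (P ^ 4) ^ m < 2 ^ (P * (4 * m)).
    move=> m0; rewrite -expnM [2 ^ _]expnM ltn_exp2r; first exact: ltn_expl.
    by rewrite muln_gt0.
  apply: leq_trans (PX _ (ltn0Sn _)) _; rewrite leq_exp2l //.
  by rewrite mulnC leq_mul2r; apply/orP; right; lia.
- have -> : n ^ 2 = b * q by rewrite -bq mulnn.
  have -> : q = P * P * P by rewrite /q !expnS expn0 muln1 mulnA.
  apply: (@leq_trans (64 * s * s.+1 * r ^ 2 * Gam.+1 * (P * b))).
    by apply: eq_leq; rewrite -/s /r /ramsey_bound /h; lia.
  apply: leq_trans (leq_mul HP (leqnn _)) _.
  have -> : b * (P * P * P) = P * (P * b) * P by lia.
  exact: leq_pmulr.
Qed.

End Order.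

Theorem theorem1p12 (H : sgraph) :
  exists c : nat, forall k : nat, 2 <= k ->
    exists2 r : nat, is_ind_ramsey H k r & r <= k ^ (c * k).
Proof.
have [s0|s0] := posnP (size (coords H)).
  have [c Hc] := selfexp_bounded_const #|H|; exists c => k k1.
  have [r Hr rH] := ind_ramsey_le (ind_arrow_trivial (k := k) (size0nil s0)).
  by exists r => //; apply: leq_trans rH (Hc k k1).
have [c Hc] := selfexp_bounded_order H; exists c => k k1.
have [G GH Gn] := ind_arrow_order k1 s0.
have [r Hr rG] := ind_ramsey_le GH.
by exists r => //; apply: leq_trans rG _; rewrite Gn; apply: Hc.
Qed.
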